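(* Let $n$ be an odd positive integer and let $m=2^l m_1$, where $m_1$ is an odd positive integer and $l\ge 1$ is an integer. Then \[K(\mathbb{Z}_m^n)=\{(x_1,x_2,\dots,x_n)\in\mathbb{Z}_m^n \mid x_1+x_2+\cdots+x_n\equiv 0 \bmod 2^l\}.\]
   Context: For positive integers $m,n$, the Ducci function is the map $D:\mathbb{Z}_m^n\to\mathbb{Z}_m^n$ (where $\mathbb{Z}_m=\mathbb{Z}/m\mathbb{Z}$) given by $D(x_1,x_2,\dots,x_n)=(x_1+x_2,\,x_2+x_3,\,\dots,\,x_n+x_1)$, all entries taken modulo $m$ (indices are cyclic modulo $n$; for $n=1$, $D(x_1)=(2x_1)$). $D^{\alpha}$ denotes the $\alpha$-fold iterate, $D^0$ being the identity. The Ducci cycle of $\mathbf{v}\in\mathbb{Z}_m^n$ is the set of all $\mathbf{w}$ for which there exist integers $\alpha\ge 0$ and $\beta\ge 1$ with $\mathbf{w}=D^{\alpha+\beta}(\mathbf{v})=D^{\alpha}(\mathbf{v})$. $K(\mathbb{Z}_m^n)$ is the set of all $\mathbf{u}\in\mathbb{Z}_m^n$ that lie in the Ducci cycle of some $\mathbf{v}\in\mathbb{Z}_m^n$. The congruence modulo $2^l$ is well defined on elements of $\mathbb{Z}_m$ because $2^l\mid m$. *)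

(* Defs.v *)
From mathcomp Require Import all_boot all_algebra.
From mathcomp Require Import boolp classical_sets.

Set Implicit Arguments.
Unset Strict Implicit.
Unset Printing Implicit Defensive.

Import GRing.Theory.

Local Open Scope ring_scope.
Local Open Scope classical_set_scope.

(* The type 'Z_m is Z/m only for m >= 2, so these definitions have their
   intended meaning only for such m. *)

(* [ordS i] is i + 1 modulo n; for n = 1 this gives D(x) = (2 x). *)
Definition ducci (m n : nat) (x : 'rV['Z_m]_n) : 'rV['Z_m]_n :=
  \row_(i < n) (x ord0 i + x ord0 (ordS i)).

Definition ducci_cycle (m n : nat) (v : 'rV['Z_m]_n) : set 'rV['Z_m]_n :=
  [set w | exists a b : nat,
     [/\ (1 <= b)%N,
         w = iter (a + b)%N (@ducci m n) v
       & iter (a + b)%N (@ducci m n) v = iter a (@ducci m n) v]].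

Definition ducci_K (m n : nat) : set 'rV['Z_m]_n :=
  [set u | exists v : 'rV['Z_m]_n, ducci_cycle v u].

Arguments ducci_K m n : clear implicits.

(* Main.v *)
(** The coordinate sum is doubled by D, and 2^l divides it iff m1 kills it in
    Z/m.  If x is periodic, its sum s satisfies s = 2^b s = 2^(lb) s, so
    m1 s = 0.  Conversely D preserves the set where m1 s = 0, and it is
    injective there: for odd n a vector of the kernel is constant with value c
    such that 2 c = 0, and m1 n c = 0 with m1 n odd forces c = 0.  An injective
    self-map of a finite set has only periodic points. *)
Require Import Defs.
From mathcomp Require Import all_boot all_algebra.
From mathcomp Require Import boolp classical_sets.

Set Implicit Arguments.
Unset Strict Implicit.
Unset Printing Implicit Defensive.

Import GRing.Theory.

Local Open Scope ring_scope.
Local Open Scope classical_set_scope.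

Lemma val_iter_ordS (n k : nat) (i : 'I_n) :
  iter k (@ordS n) i = ((i + k) %% n)%N :> nat.
Proof.
elim: k => [|k IHk]; first by rewrite addn0 modn_small.
by rewrite iterS /= IHk addnS -addn1 modnDml addn1.
Qed.

Lemma mulrn_odd_double0 (V : zmodType) (c : V) (k : nat) :
  odd k -> c *+ 2 = 0 -> c *+ k = c.
Proof.
by move=> k_odd c20; rewrite -[k]odd_double_half k_odd -mul2n mulrnDr mulrnA
  c20 mul0rn addr0.
Qed.

Lemma sum_ducci (m n : nat) (x : 'rV['Z_m]_n) :
  \sum_(i < n) ducci x ord0 i = (\sum_(i < n) x ord0 i) *+ 2.
Proof.
under eq_bigr do rewrite mxE.
rewrite big_split /= mulr2n; congr (_ + _).
by rewrite [RHS](reindex_inj (can_inj (@ordSK n))).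
Qed.

Lemma sum_iter_ducci (m n k : nat) (x : 'rV['Z_m]_n) :
  \sum_(i < n) iter k (@ducci m n) x ord0 i = (\sum_(i < n) x ord0 i) *+ 2 ^ k.
Proof.
elim: k => [//|k IHk].
by rewrite iterS sum_ducci IHk -mulrnA -expnSr.
Qed.

Lemma ducciB (m n : nat) (x y : 'rV['Z_m]_n) :
  ducci (x - y) = ducci x - ducci y.
Proof. by apply/rowP => i; rewrite !mxE opprD addrACA. Qed.

(** Each shift of the index negates the entry. Going once round the cycle multiplies it by (-1)^n =
    -1, so every entry is its own negative and the alternating signs disappear. *)
Lemma ducci_ker_const (m n : nat) (z : 'rV['Z_m]_n) :
  odd n -> ducci z = 0 ->
  forall i j, z ord0 j = z ord0 i /\ z ord0 i *+ 2 = 0.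
Proof.
move=> n_odd /rowP Dz0.
have zS i : z ord0 (ordS i) = - z ord0 i.
  by apply/eqP; rewrite -addr_eq0 addrC; have := Dz0 i; rewrite !mxE => ->.
have z_iter k i : z ord0 (iter k (@ordS n) i) = (-1) ^+ k * z ord0 i.
  elim: k => [|k IHk]; first by rewrite mul1r.
  by rewrite iterS zS IHk exprS mulN1r mulNr.
have zN i : - z ord0 i = z ord0 i.
  have iter_n : iter n (@ordS n) i = i.
    by apply: val_inj; rewrite /= val_iter_ordS modnDr modn_small.
  by rewrite -[in RHS]iter_n z_iter -signr_odd n_odd mulN1r.
move=> i j; split; last by rewrite mulr2n -{1}zN addNr.
(* Since [i < n], the truncated subtraction is exact: [n - i] shifts lead from [i] to 0, and [j]
   more lead to [j]. *)
have -> : j = iter (n - i + j) (@ordS n) i.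
  apply: val_inj; rewrite /= val_iter_ordS addnA subnKC; last exact: ltnW.
  by rewrite modnDl modn_small.
by rewrite z_iter -signr_odd; case: odd; rewrite ?mulN1r ?mul1r ?zN.
Qed.

(** Cancel [e] in d * e | s * e. The case d = 1 says that [m] kills Z/m. *)
Lemma Zp_mulrn_eq0 (m d e : nat) (s : 'Z_m) :
  (1 < m)%N -> m = (d * e)%N -> (s *+ e == 0) = (d %| s)%N.
Proof.
move=> m_gt1 m_de.
have e_gt0 : (0 < e)%N by case: e m_de m_gt1 => // ->; rewrite muln0.
rewrite -[in LHS](natr_Zp s) -mulrnA -(dvdn_pmul2r e_gt0) -m_de.
by rewrite -val_eqE /= val_Zp_nat.
Qed.

Theorem theorem3 (n m l m1 : nat) (hn : odd n) (hm1 : odd m1) (hl : (1 <= l)%N)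
    (hm : m = (2 ^ l * m1)%N) :
  ducci_K m n =
  [set x : 'rV['Z_m]_n |
     (nat_of_ord (\sum_(i < n) x ord0 i)%R = 0 %[mod 2 ^ l])%N].
Proof.
have m_gt1 : (1 < m)%N.
  rewrite hm; apply: (@leq_trans (2 ^ l)); last by rewrite leq_pmulr // odd_gt0.
  by rewrite -{1}(expn0 2) ltn_exp2l.
have sumE (x : 'rV['Z_m]_n) :
    (nat_of_ord (\sum_(i < n) x ord0 i)%R = 0 %[mod 2 ^ l])%N <->
    (\sum_(i < n) x ord0 i) *+ m1 == 0.
  by rewrite (Zp_mulrn_eq0 _ m_gt1 hm) /dvdn mod0n; split=> /eqP.
apply/seteqP; split=> [_ [v [a [b [b_gt0 -> per]]]] | x] /=.
  rewrite per; apply/sumE; set s := \sum_(i < n) _.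
  have s2b : s = s *+ 2 ^ b by rewrite -sum_iter_ducci -iterD addnC per.
  (* Going round the cycle [l] times makes the exponent at least [l], so that a factor 2^l can be
     split off and joined with [m1] to give [m]. *)
  have s2bk k : s = s *+ 2 ^ (b * k).
    by elim: k => [|k IHk]; rewrite ?muln0 // mulnS expnD mulrnA -s2b.
  have le_lb : (l <= b * l)%N by rewrite leq_pmull.
  rewrite [s](s2bk l) -(subnK le_lb) expnD mulrnA -(mulrnA _ (2 ^ l)) -hm.
  by rewrite (@Zp_mulrn_eq0 m 1) ?mul1n ?dvd1n.
rewrite sumE => sum_x; exists x.
pose S : {pred 'rV['Z_m]_n} :=
  [pred y : 'rV['Z_m]_n | (\sum_(i < n) y ord0 i) *+ m1 == 0].
have S_ducci : {in S, forall y, ducci y \in S}.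
  by move=> y; rewrite !inE sum_ducci mulrnAC => /eqP ->; rewrite mul0rn.
have inj_ducci : {in S &, injective (@ducci m n)}.
  move=> y z; rewrite !inE => /eqP Sy /eqP Sz Dyz.
  apply/subr0_eq/rowP => i; rewrite [RHS]mxE.
  have Dyz0 : ducci (y - z) = 0 by rewrite ducciB Dyz subrr.
  have const := ducci_ker_const hn Dyz0 i.
  have [_ c20] := const i.
  have : (\sum_(j < n) (y - z) ord0 j) *+ m1 = 0.
    under eq_bigr do rewrite !mxE.
    by rewrite sumrB mulrnBl Sy Sz subrr.
  (* The sum is [n] copies of the constant c, so c *+ (n * m1) = 0; as n * m1 is odd and 2 c = 0,
     the left side is c itself. *)
  rewrite (eq_bigr _ (fun j _ => (const j).1)) sumr_const card_ord -mulrnA.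
  by rewrite (mulrn_odd_double0 _ c20) // oddM hn.
(* Being periodic, [x] lies in its own cycle, with its orbit size as period. *)
exists 0%N, (order (@ducci m n) x); rewrite add0n order_gt0.
by rewrite (iter_order_in S_ducci inj_ducci).
Qed.
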